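(* Let $m\ge3$ and let $X_{\mathcal M}$ be a strict Type $\mathcal S$ source. Then omnivocal communication is necessary for achieving SK capacity: for every $T\subset\mathcal M$ with $|T|=m-1$, $$\mathbf I_T(X_{\mathcal M})<\mathbf I(X_{\mathcal M}).$$
   Context: Let $\mathcal M=\{1,\dots,m\}$, and let $X_{\mathcal M}=(X_1,\dots,X_m)$ be jointly distributed finite-valued random variables, observed as $n$ i.i.d. copies $X^n_{\mathcal M}$; $X_A=(X_i:i\in A)$. Communication, CR, SK. An interactive communication $\mathbf F$ is a finite sequence of transmissions, each made by a terminal $i$ as a deterministic function of $X^n_i$ and earlier transmissions. A CR from $\mathbf F$ is a sequence $\mathbf J$ of functions of $X^n_{\mathcal M}$ such that for every $0<\epsilon<1$ and large $n$, there exist $J_i(X^n_i,\mathbf F)$ with $\Pr[J_1=\cdots=J_m=\mathbf J]\ge1-\epsilon$. $R$ is an achievable SK rate if some CR $\mathbf K$ from some $\mathbf F$ satisfies, for every $\epsilon>0$ and large $n$, $I(\mathbf K;\mathbf F)\le\epsilon$ and $\frac1nH(\mathbf K)\ge R-\epsilon$. Multipartite information. $\Delta(\mathcal P)=\frac1{|\mathcal P|-1}[\sum_{A\in\mathcal P}H(X_A)-H(X_{\mathcal M})]$ for partitions with at least 2 cells, and $\mathbf I(X_{\mathcal M})=\min_{\mathcal P}\Delta(\mathcal P)$; this equals the SK capacity (supremum of achievable SK rates). The source is strict Type $\mathcal S$ if the singleton partition $\{\{1\},\dots,\{m\}\}$ is the unique minimizer. Silent terminals. For $T\subsetneq\mathcal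 M$, $\mathbf I_T(X_{\mathcal M})$ is the supremum of achievable SK rates when only interactive communications in which only terminals in $T$ transmit are allowed. *)

(* Defs.v *)
From Stdlib Require Import Reals.
From mathcomp Require Import all_boot.

Set Implicit Arguments.
Unset Strict Implicit.
Unset Printing Implicit Defensive.
Local Open Scope R_scope.

Section InfoTheory.

(* Common finite alphabet A; terminals 'I_m; one source letter is a
   function 'I_m -> A. *)
Variables (A : finType) (m : nat).

Definition letter := {ffun 'I_m -> A}.

Definition sumR (S : finType) (E : pred S) (f : S -> R) : R :=
  foldr (fun s acc => f s + acc) 0 (enum E).
Definition prodR (S : finType) (f : S -> R) : R :=
  foldr (fun s acc => f s * acc) 1 (enum S).

Definition is_pmf (S : finType) (p : S -> R) : Prop :=
  (forall s, (0 <= p s)) /\ sumR predT p = 1.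

Definition prob (S : finType) (p : S -> R) (E : pred S) : R :=
  sumR E p.

(* Shannon entropy (natural log) of the random variable f under p:
   H(f) = - sum_s p(s) ln Pr[f = f s]  (= - sum_b Pr[f=b] ln Pr[f=b]). *)
Definition entropy (S : finType) (p : S -> R) (T : eqType) (f : S -> T) : R :=
  - sumR predT (fun s => p s * ln (prob p (fun s' => f s' == f s))).

Definition mutinf (S : finType) (p : S -> R) (T1 T2 : eqType)
  (f : S -> T1) (g : S -> T2) : R :=
  (entropy p f + entropy p g - entropy p (fun s => (f s, g s))).

Definition restr (B : {set 'I_m}) (x : letter) : {ffun 'I_m -> option A} :=
  [ffun i => if i \in B then Some (x i) else None].

Definition HX (P : letter -> R) (B : {set 'I_m}) : R := entropy P (restr B).

Definition Delta (P : letter -> R) (Q : {set {set 'I_m}}) : R :=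
  (/ INR (#|Q| - 1)%N *
     (sumR (mem Q) (HX P) - HX P [set: 'I_m])).

Definition admissible (Q : {set {set 'I_m}}) : bool :=
  partition Q [set: 'I_m] && (1 < #|Q|)%N.

Definition singletons : {set {set 'I_m}} := [set [set i] | i : 'I_m].

(* I(X_M) := min over admissible partitions of Delta; singletons is
   admissible whenever m >= 2, so it serves as seed of the min. *)
Definition MI (P : letter -> R) : R :=
  foldr (fun Q acc => Rmin (Delta P Q) acc) (Delta P singletons)
        (enum admissible).

Definition strict_typeS (P : letter -> R) : Prop :=
  forall Q, admissible Q -> Q != singletons ->
    (Delta P singletons < Delta P Q).

Definition block (n : nat) := {ffun 'I_n -> letter}.

Definition pn (P : letter -> R) (n : nat) (x : block n) : R :=
  prodR (fun t : 'I_n => P (x t)).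

Definition obs (n : nat) (i : 'I_m) (x : block n) : {ffun 'I_n -> A} :=
  [ffun t => x t i].

(* A transmission: the speaking terminal i and a deterministic function of
   X_i^n and of the earlier transmissions (messages coded as naturals). *)
Definition protocol (n : nat) :=
  seq ('I_m * ({ffun 'I_n -> A} -> seq nat -> nat)).

Fixpoint run (n : nat) (pr : protocol n) (x : block n) (acc : seq nat)
  : seq nat :=
  match pr with
  | [::] => acc
  | (i, g) :: pr' => run pr' x (rcons acc (g (obs i x) acc))
  end.

Definition transcript (n : nat) (pr : protocol n) (x : block n) : seq nat :=
  run pr x [::].

Definition speakers_in (T : {set 'I_m}) (n : nat) (pr : protocol n) : bool :=
  all (fun st => st.1 \in T) pr.

Definition is_CR (P : letter -> R) (F : forall n, protocol n)
  (J : forall n, block n -> nat) : Prop :=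
  forall eps : R, (0 < eps < 1) ->
    exists N : nat, forall n : nat, (N <= n)%N ->
      exists Js : 'I_m -> {ffun 'I_n -> A} -> seq nat -> nat,
        (prob (pn P (n:=n))
           (fun x => [forall i, Js i (obs i x) (transcript (F n) x) == J n x])
         >= 1 - eps).

Definition achievable_T (P : letter -> R) (T : {set 'I_m}) (Rate : R) : Prop :=
  exists (F : forall n, protocol n) (K : forall n, block n -> nat),
    (forall n, speakers_in T (F n)) /\
    is_CR P F K /\
    forall eps : R, (0 < eps) ->
      exists N : nat, forall n : nat, (N <= n)%N ->
        (mutinf (pn P (n:=n)) (K n) (transcript (F n)) <= eps) /\
        (/ INR n * entropy (pn P (n:=n)) (K n) >= Rate - eps).

End InfoTheory.

Definition I_T (A : finType) (m : nat) (P : letter A m -> R)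
  (T : {set 'I_m}) (c : R) : Prop :=
  is_lub (achievable_T P T) c.

(* Main.v *)
(** Write T = M \ {u}, with t = m - 1 terminals.  The total correlation
    sum_(i in T) H(X_i|F) - H(X_T|F) does not increase along transmissions
    made by terminals of T, since a transmission by i removes the same entropy
    from H(X_i|F) and H(X_T|F) and the other terms cannot grow.  When every
    i in T recovers K from (X_i, F), it is at least (t - 1) H(K|F) up to a Fano
    error.  Hence every rate achievable with u silent is at most
      c = (sum_(i in T) H(X_i) - H(X_T)) / (m - 2).
    Finally (m - 1) Delta(S) = (m - 2) c + Delta({T, {u}}), where S is the
    singleton partition, and Delta(S) < Delta({T, {u}}), so c < Delta(S). *)
Require Import Defs.
From Stdlib Require Import Reals Lra.
From HB Require Import structures.
From mathcomp Require Import all_boot.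

Set Implicit Arguments.
Unset Strict Implicit.
Unset Printing Implicit Defensive.
Local Open Scope R_scope.

(** * Finite sums and products of real numbers *)

HB.instance Definition _ := Monoid.isComLaw.Build R 0 Rplus
  (fun x y z => esym (Rplus_assoc x y z)) Rplus_comm Rplus_0_l.
HB.instance Definition _ := Monoid.isComLaw.Build R 1 Rmult
  (fun x y z => esym (Rmult_assoc x y z)) Rmult_comm Rmult_1_l.
HB.instance Definition _ := Monoid.isMulLaw.Build R 0 Rmult Rmult_0_l Rmult_0_r.
HB.instance Definition _ := Monoid.isAddLaw.Build R Rmult Rplus
  (fun x y z => Rmult_plus_distr_r x y z) Rmult_plus_distr_l.

Local Notation "\sum_ ( i <- r ) F" := (\big[Rplus/0]_(i <- r) F) : R_scope.
Local Notation "\sum_ ( i | P ) F" := (\big[Rplus/0]_(i | P%B) F) : R_scope.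
Local Notation "\sum_ ( i 'in' A ) F" := (\big[Rplus/0]_(i in A) F) : R_scope.
Local Notation "\sum_ ( i : t ) F" := (\big[Rplus/0]_(i : t) F)
  (only parsing) : R_scope.
Local Notation "\sum_ i F" := (\big[Rplus/0]_i F) : R_scope.
Local Notation "\prod_ i F" := (\big[Rmult/1]_i F) : R_scope.

Lemma sumRE (S : finType) (E : pred S) (f : S -> R) :
  sumR E f = \sum_(s | E s) f s.
Proof.
rewrite /sumR; transitivity (\sum_(s <- enum E) f s); last by rewrite big_enum.
by elim: (enum _) => [|x s IH]; rewrite ?big_nil ?big_cons //= IH.
Qed.

Lemma prodRE (S : finType) (f : S -> R) : prodR f = \prod_s f s.
Proof.
rewrite /prodR; transitivity (\big[Rmult/1]_(s <- enum S) f s); last by rewrite big_enum.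
by elim: (enum _) => [|x s IH]; rewrite ?big_nil ?big_cons //= IH.
Qed.

Lemma leR_sum (I : Type) (r : seq I) (Q : pred I) (f g : I -> R) :
  (forall i, Q i -> f i <= g i) ->
  \big[Rplus/0]_(i <- r | Q i) f i <= \big[Rplus/0]_(i <- r | Q i) g i.
Proof.
by move=> fg; elim/big_ind2: _ => // [|*]; [lra | exact: Rplus_le_compat].
Qed.

Lemma sumR_ge0 (I : Type) (r : seq I) (Q : pred I) (f : I -> R) :
  (forall i, Q i -> 0 <= f i) -> 0 <= \big[Rplus/0]_(i <- r | Q i) f i.
Proof. by move=> f0; elim/big_ind: _ => // [|*]; lra. Qed.

Lemma sumR_opp (I : Type) (r : seq I) (Q : pred I) (f : I -> R) :
  \big[Rplus/0]_(i <- r | Q i) (- f i) = - \big[Rplus/0]_(i <- r | Q i) f i.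
Proof. by elim/big_ind2: _ => // [|*]; lra. Qed.

Lemma sumR_sub (I : Type) (r : seq I) (Q : pred I) (f g : I -> R) :
  \big[Rplus/0]_(i <- r | Q i) (f i - g i) =
  \big[Rplus/0]_(i <- r | Q i) f i - \big[Rplus/0]_(i <- r | Q i) g i.
Proof. by rewrite /Rminus big_split sumR_opp. Qed.

Lemma sumR_const (I : finType) (Q : {pred I}) (a : R) :
  \sum_(i in Q) a = INR #|Q| * a.
Proof.
rewrite big_const; elim: #|Q| => [|k IH] /=; first by rewrite Rmult_0_l.
by rewrite IH -/(INR k.+1) S_INR; ring.
Qed.

(** * Entropy on a finite space: Gibbs, submodularity and Fano *)

Section Entropy.

Variables (S : finType) (p : S -> R).
Hypothesis p_pmf : is_pmf p.

Lemma pmf_ge0 s : 0 <= p s. Proof. by case: p_pmf. Qed.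
Lemma pmf_sum : \sum_s p s = 1. Proof. by case: p_pmf; rewrite sumRE. Qed.
Hint Resolve pmf_ge0 : core.

Lemma probE (E : pred S) : prob p E = \sum_(s | E s) p s.
Proof. exact: sumRE. Qed.

Lemma prob_ge0 (E : pred S) : 0 <= prob p E.
Proof. by rewrite probE; apply: sumR_ge0. Qed.

Lemma prob_le (E E' : pred S) : (forall s, E s -> E' s) -> prob p E <= prob p E'.
Proof.
move=> EE'; rewrite !probE big_mkcond [X in _ <= X]big_mkcond.
apply: leR_sum => s _; case Es: (E s); first by rewrite EE' //; lra.
by case: (E' s) => //; lra.
Qed.

Lemma prob_compl (E : pred S) : prob p E + prob p (fun s => ~~ E s) = 1.
Proof. by rewrite !probE -pmf_sum [in RHS](bigID E). Qed.

Lemma prob_gt0 (E : pred S) s : 0 < p s -> E s -> 0 < prob p E.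
Proof.
move=> ps Es; rewrite probE (bigD1 s) //=.
by apply: Rplus_lt_le_0_compat => //; apply: sumR_ge0.
Qed.

Lemma eq_prob (E E' : pred S) : E =1 E' -> prob p E = prob p E'.
Proof. by move=> EE'; rewrite !probE; apply: eq_bigl. Qed.

Lemma entropyE (T : eqType) (f : S -> T) :
  entropy p f = \sum_s p s * - ln (prob p (fun s' => f s' == f s)).
Proof.
rewrite /entropy sumRE -sumR_opp; apply: eq_bigr => s _.
by rewrite Ropp_mult_distr_r.
Qed.

(** Each fibre of [f] lies inside a fibre of [g], so the logarithms compare pointwise. Points of
    mass zero are split off because monotonicity of [ln] needs a positive argument. *)
Lemma entropy_le (T T' : eqType) (f : S -> T) (g : S -> T') :
  (forall s s', f s = f s' -> g s = g s') -> entropy p g <= entropy p f.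
Proof.
move=> fg; rewrite !entropyE; apply: leR_sum => s _.
case: (pmf_ge0 s) => [ps|<-]; last lra.
apply: Rmult_le_compat_l => //; apply: Ropp_le_contravar.
have gt0 : 0 < prob p (fun s' => f s' == f s) by apply: (@prob_gt0 _ s).
have [|lt|->] := @prob_le (fun s' => f s' == f s) (fun s' => g s' == g s).
- by move=> s' /eqP e; apply/eqP; apply: fg.
- by left; apply: ln_increasing.
- exact: Rle_refl.
Qed.

Lemma eq_entropy (T T' : eqType) (f : S -> T) (g : S -> T') :
  (forall s s', f s = f s' <-> g s = g s') -> entropy p f = entropy p g.
Proof. by move=> fg; apply: Rle_antisym; apply: entropy_le => s s' /fg. Qed.

Lemma sum_fiber (T : finType) (f : S -> T) (w : T -> R) :
  \sum_s p s * w (f s) = \sum_t prob p (fun s => f s == t) * w t.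
Proof.
rewrite (partition_big f predT) //=; apply: eq_bigr => t _.
by rewrite probE big_distrl; apply: eq_bigr => s /eqP ->.
Qed.

(** Averages the pointwise bound [ln r <= r - 1] over [p]. *)
Lemma gibbs (r : S -> R) :
  (forall s, 0 < p s -> 0 < r s) -> \sum_s p s * r s <= 1 ->
  \sum_s p s * ln (r s) <= 0.
Proof.
move=> r0 r1.
apply: (@Rle_trans _ (\sum_s (p s * r s - p s))); last first.
  by rewrite sumR_sub pmf_sum; lra.
apply: leR_sum => s _.
case: (pmf_ge0 s) => [ps|<-]; last lra.
have -> : p s * r s - p s = p s * (r s - 1) by ring.
apply: Rmult_le_compat_l => //.
have := exp_ineq1_le (ln (r s)); rewrite exp_ln; [lra | exact: r0].
Qed.

(** Predicting [f] from [g] with a kernel [q] costs at least the conditional entropy: the gap is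
    Gibbs applied to the ratio of [q] to the true conditional law. Submodularity and Fano both
    follow by choosing [q]. Asking only for total mass at most 1 admits kernels that vanish where
    the conditioning event is null. *)
Lemma cross_entropy_fin (T U : finType) (f : S -> T) (g : S -> U)
    (q : T -> U -> R) :
  (forall t u, 0 <= q t u) -> (forall u, \sum_t q t u <= 1) ->
  (forall s, 0 < p s -> 0 < q (f s) (g s)) ->
  entropy p (fun s => (f s, g s)) - entropy p g <=
    \sum_s p s * - ln (q (f s) (g s)).
Proof.
move=> q0 q1 qpos.
set pfg := fun tu : T * U => prob p (fun s => (f s, g s) == tu).
set pg := fun u : U => prob p (fun s => g s == u).
have pfg_gt0 s : 0 < p s -> 0 < pfg (f s, g s) by move=> ps; apply: (@prob_gt0 _ s).
have pg_gt0 s : 0 < p s -> 0 < pg (g s) by move=> ps; apply: (@prob_gt0 _ s).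
set r := fun s => q (f s) (g s) * pg (g s) * / pfg (f s, g s).
have r_gt0 s : 0 < p s -> 0 < r s.
  move=> ps; apply: Rmult_lt_0_compat; last exact/Rinv_0_lt_compat/pfg_gt0.
  by apply: Rmult_lt_0_compat; [exact: qpos | exact: pg_gt0].
have: \sum_s p s * ln (r s) <= 0.
  apply: gibbs => //.
  rewrite (sum_fiber (fun s => (f s, g s))
    (fun tu => q tu.1 tu.2 * pg tu.2 * / pfg tu)).
  apply: (@Rle_trans _ (\sum_(tu : T * U) q tu.1 tu.2 * pg tu.2)).
    apply: leR_sum => tu _; rewrite -/(pfg tu).
    have qp : 0 <= q tu.1 tu.2 * pg tu.2.
      by apply: Rmult_le_pos => //; apply: prob_ge0.
    (* A pair of values of mass zero contributes nothing on the left, whatever the value of the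
       inverse. *)
    case: (Req_dec (pfg tu) 0) => [->|pn0]; first by rewrite Rmult_0_l.
    by right; field.
  rewrite -(pair_bigA _ (fun t u => q t u * pg u)) exchange_big /=.
  apply: (@Rle_trans _ (\sum_u pg u)).
    apply: leR_sum => u _; rewrite -big_distrl /= -{2}[pg u]Rmult_1_l.
    by apply: Rmult_le_compat_r; first exact: prob_ge0.
  right; rewrite -pmf_sum.
  have := sum_fiber g (fun _ => 1).
  rewrite (eq_bigr p) => [->|s _]; last by rewrite Rmult_1_r.
  by apply: eq_bigr => u _; rewrite Rmult_1_r.
suff -> : \sum_s p s * ln (r s) =
    entropy p (fun s => (f s, g s)) - entropy p g -
    \sum_s p s * - ln (q (f s) (g s)) by lra.
rewrite !entropyE -!sumR_sub; apply: eq_bigr => s _.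
case: (pmf_ge0 s) => [ps|<-]; last lra.
rewrite -/(pg (g s)) -/(pfg (f s, g s)) /r.
rewrite !ln_mult ?ln_Rinv; try ring; auto.
- by apply: Rmult_lt_0_compat; auto.
- exact/Rinv_0_lt_compat/pfg_gt0.
Qed.

(** A canonical point in the fibre of [s]. It replaces a variable with values in an arbitrary
    [eqType], such as a transcript, by one with values in the finite space [S] and with the same
    fibres, hence the same entropy; sums over values then make sense. *)
Definition rep (T : eqType) (f : S -> T) (s : S) : S :=
  odflt s [pick s' | f s' == f s].

Lemma rep_pick (T : eqType) (f : S -> T) s :
  [pick s' | f s' == f s] = Some (rep f s).
Proof. by rewrite /rep; case: pickP => // /(_ s); rewrite eqxx. Qed.

Lemma repK (T : eqType) (f : S -> T) s : f (rep f s) = f s.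
Proof. by rewrite /rep; case: pickP => [s' /eqP|]. Qed.

Lemma rep_eq (T : eqType) (f : S -> T) s s' :
  rep f s = rep f s' <-> f s = f s'.
Proof.
split=> [e | e]; first by rewrite -(repK f s) e repK.
by apply: Some_inj; rewrite -!rep_pick e.
Qed.

(** The conditional law of [f] given [h], used as a kernel that sees [(g, h)] but ignores [g], has
    cross entropy exactly H(f|h); the true H(f|g,h) cannot exceed it. *)
Lemma entropy_submod (T U V : eqType) (f : S -> T) (g : S -> U) (h : S -> V) :
  entropy p (fun s => (f s, (g s, h s))) + entropy p h <=
    entropy p (fun s => (f s, h s)) + entropy p (fun s => (g s, h s)).
Proof.
set f' := rep f; set g' := rep g; set h' := rep h.
have e1 : entropy p h = entropy p h'.
  by apply: eq_entropy => s s'; rewrite rep_eq.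
have e2 : entropy p (fun s => (f s, h s)) = entropy p (fun s => (f' s, h' s)).
  by apply: eq_entropy => s s'; split=> -[/rep_eq ? /rep_eq ?]; congr pair.
have e3 : entropy p (fun s => (g s, h s)) = entropy p (fun s => (g' s, h' s)).
  by apply: eq_entropy => s s'; split=> -[/rep_eq ? /rep_eq ?]; congr pair.
have e4 : entropy p (fun s => (f s, (g s, h s))) =
          entropy p (fun s => (f' s, (g' s, h' s))).
  by apply: eq_entropy => s s'; split=> -[/rep_eq ? /rep_eq ? /rep_eq ?];
     congr (_, (_, _)).
rewrite {}e1 {}e2 {}e3 {}e4.
pose ph v := prob p (fun s => h' s == v).
pose pfh t v := prob p (fun s => (f' s, h' s) == (t, v)).
pose q t (uv : S * S) := pfh t uv.2 * / ph uv.2.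
(* Since [/ 0 = 0], the kernel is zero where [h'] has no mass. *)
have inv_ph v : 0 <= / ph v.
  case: (Rle_lt_or_eq_dec 0 (ph v)) => [|lt|<-]; first exact: prob_ge0.
    by left; apply: Rinv_0_lt_compat.
  by rewrite Rinv_0; apply: Rle_refl.
have q0 t uv : 0 <= q t uv by apply: Rmult_le_pos => //; apply: prob_ge0.
have q1 uv : \sum_t q t uv <= 1.
  rewrite -big_distrl /=.
  have -> : \sum_t pfh t uv.2 = ph uv.2.
    rewrite /ph probE [RHS](partition_big f' predT) //=; apply: eq_bigr => t _.
    by rewrite /pfh probE; apply: eq_bigl => s; rewrite xpair_eqE andbC.
  case: (Req_dec (ph uv.2) 0) => [->|n0]; first by rewrite Rmult_0_l; lra.
  by rewrite Rinv_r //; lra.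
have pfh_gt0 s : 0 < p s -> 0 < pfh (f' s) (h' s).
  by move=> ps; apply: (@prob_gt0 _ s).
have ph_gt0 s : 0 < p s -> 0 < ph (h' s) by move=> ps; apply: (@prob_gt0 _ s).
have qpos s : 0 < p s -> 0 < q (f' s) (g' s, h' s).
  move=> ps; apply: Rmult_lt_0_compat; first exact: pfh_gt0.
  exact/Rinv_0_lt_compat/ph_gt0.
have : entropy p (fun s => (f' s, (g' s, h' s))) -
       entropy p (fun s => (g' s, h' s)) <=
       \sum_s p s * - ln (q (f' s) (g' s, h' s)).
  exact: (@cross_entropy_fin _ _ f' (fun s => (g' s, h' s)) q q0 q1 qpos).
suff -> : \sum_s p s * - ln (q (f' s) (g' s, h' s)) =
    entropy p (fun s => (f' s, h' s)) - entropy p h' by lra.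
rewrite !entropyE -sumR_sub; apply: eq_bigr => s _.
case: (pmf_ge0 s) => [ps|<-]; last lra.
rewrite -/(ph (h' s)) -/(pfh (f' s) (h' s)) /q /= ln_mult ?ln_Rinv; auto.
  by ring.
exact/Rinv_0_lt_compat/ph_gt0.
Qed.

Lemma card_pmf_gt0 : (0 < #|S|)%N.
Proof.
rewrite lt0n; apply/eqP => /card0_eq S0.
by have := pmf_sum; rewrite big_pred0 => [?|s]; [lra | have := S0 s; rewrite inE].
Qed.

(** Cross entropy against a kernel centred on the guess. The alphabet size is replaced by [#|S|],
    which bounds the number of values of [K] even when its codomain is infinite. *)
Lemma fano (T U : eqType) (K : S -> T) (Y : S -> U) (phi : U -> T) (e : R) :
  1 - e <= prob p (fun s => phi (Y s) == K s) ->
  entropy p (fun s => (K s, Y s)) - entropy p Y <= ln 2 + e * ln (INR #|S|).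
Proof.
move=> he.
set K' := rep K; set Y' := rep Y.
have -> : entropy p Y = entropy p Y'.
  by apply: eq_entropy => s s'; rewrite rep_eq.
have -> : entropy p (fun s => (K s, Y s)) = entropy p (fun s => (K' s, Y' s)).
  by apply: eq_entropy => s s'; split=> -[/rep_eq ? /rep_eq ?]; congr pair.
have N1 : 1 <= INR #|S|.
  by rewrite -[1]/(INR 1); apply/le_INR/leP/card_pmf_gt0.
have lnN : 0 <= ln (INR #|S|).
  by rewrite -ln_1; case: N1 => [lt|<-]; [left; apply: ln_increasing; lra | right].
(* The guess is encoded by the representative that [rep K] picks, so a correct guess is exactly
   [K' s]. *)
pose guess u := [pick k | K k == phi (Y u)].
(* Half the mass sits on the guess, half is uniform, so a wrong guess costs
   only [ln 2 + ln #|S|]. *)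
pose q k u := (if guess u == Some k then / 2 else 0) + / 2 * / INR #|S|.
have hN : 0 < / INR #|S| by apply: Rinv_0_lt_compat; lra.
have q0 k u : 0 < q k u by rewrite /q; case: ifP => _; lra.
have q1 u : \sum_k q k u <= 1.
  rewrite big_split /=.
  have -> : \sum_(k : S) / 2 * / INR #|S| = / 2.
    transitivity (INR #|S| * (/ 2 * / INR #|S|)); last by field; lra.
    exact: (sumR_const predT).
  rewrite -big_mkcond /=; case: (guess u) => [k|]; last first.
    by rewrite big_pred0 //=; lra.
  by rewrite (big_pred1 k) => [|k']; [lra | rewrite eq_sym].
apply: Rle_trans (@cross_entropy_fin _ _ K' Y' q _ q1 _) _ => //.
  by move=> *; left.
apply: (@Rle_trans _ (\sum_s (p s * ln 2 +
    (if phi (Y s) != K s then p s else 0) * ln (INR #|S|)))).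
  apply: leR_sum => s _.
  suff lq : - ln (q (K' s) (Y' s)) <=
      ln 2 + (if phi (Y s) != K s then 1 else 0) * ln (INR #|S|).
    have := Rmult_le_compat_l _ _ _ (pmf_ge0 s) lq.
    by case: (_ != _); lra.
  have mono x y : 0 < x -> x <= y -> - ln y <= - ln x.
    move=> x0 [/(ln_increasing _ _ x0)|->]; last exact: Rle_refl.
    by move=> ?; left; apply: Ropp_lt_contravar.
  have ln2V : ln (/ 2) = - ln 2 by apply: ln_Rinv; lra.
  have lnNV : ln (/ INR #|S|) = - ln (INR #|S|) by apply: ln_Rinv; lra.
  case: eqP => [ok|_] /=.
    suff : - ln (q (K' s) (Y' s)) <= - ln (/ 2) by lra.
    apply: mono; first lra.
    by rewrite /q /guess /Y' repK ok rep_pick eqxx; lra.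
  suff : - ln (q (K' s) (Y' s)) <= - ln (/ 2 * / INR #|S|).
    rewrite ln_mult ?ln2V ?lnNV; [|lra|done].
    by move: (ln (q _ _)) (ln (INR _)) => lnq lnN'; lra.
  apply: mono; first by apply: Rmult_lt_0_compat; lra.
  by rewrite /q; case: ifP => _; lra.
rewrite big_split /= -!big_distrl /= pmf_sum -big_mkcond /= -probE.
have := prob_compl (fun s => phi (Y s) == K s) => /= hc.
have hW : prob p (fun s => phi (Y s) != K s) <= e by lra.
apply: Rplus_le_compat; first by right; ring.
exact: Rmult_le_compat_r.
Qed.

End Entropy.

(* [lra] compares atoms syntactically, but the codomain of a random variable
   may be spelled [list (Equality.sort U)] or [Equality.sort (list U)];
   [set] identifies the two. *)
Ltac entropy_lra :=
  repeat match goal with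
  | |- context [@entropy ?S ?p ?T ?f] =>
      let h := fresh in set h := (@entropy S p T f); clearbody h
  end; lra.

(** * Conditional total correlation under communication *)

Section TotalCorrelation.

Variables (S : finType) (p : S -> R).
Hypothesis p_pmf : is_pmf p.
Variables (I : finType) (U : eqType) (X : I -> S -> U).

Definition joint (r : seq I) (s : S) : seq U := [seq X i s | i <- r].

Lemma joint_inj (r : seq I) s s' i :
  joint r s = joint r s' -> i \in r -> X i s = X i s'.
Proof. by move=> /eq_in_map e /e. Qed.

(** Each conditional entropy given [W] is written as a joint entropy minus the entropy of [W]. *)
Definition total_corr (T : {set I}) (V : eqType) (W : S -> V) : R :=
  \sum_(i in T) (entropy p (fun s => (X i s, W s)) - entropy p W) -
  (entropy p (fun s => (joint (enum T) s, W s)) - entropy p W).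

(** Nonnegativity of total correlation given [W], peeling off one variable at a time by
    submodularity. *)
Lemma joint_entropy_le (V : eqType) (W : S -> V) (r : seq I) :
  entropy p (fun s => (joint r s, W s)) - entropy p W <=
  \sum_(i <- r) (entropy p (fun s => (X i s, W s)) - entropy p W).
Proof.
elim: r => [|i r IH].
  rewrite big_nil (@eq_entropy _ _ p_pmf _ _ _ W) => [|s s']; first entropy_lra.
  by split=> [[]|->].
rewrite big_cons.
have := entropy_submod p_pmf (X i) (joint r) W.
rewrite (@eq_entropy _ _ p_pmf _ _ (fun s => (joint (i :: r) s, W s))
   (fun s => (X i s, (joint r s, W s)))) => [|s s'].
  by move: IH; entropy_lra.
by split=> /= -[-> -> ->].
Qed.

(** [W'] is [W] with one message of [i] appended. Since [(X i, W)] determines [W'], the term of [i]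
    and the joint term both lose H(W'|W), which cancels; every other term shrinks because
    conditioning reduces entropy. *)
Lemma total_corr_step (T : {set I}) (i : I) (V V' : eqType)
    (W : S -> V) (W' : S -> V') :
  i \in T -> (forall s s', W' s = W' s' -> W s = W s') ->
  (forall s s', X i s = X i s' -> W s = W s' -> W' s = W' s') ->
  total_corr T W' <= total_corr T W.
Proof.
move=> iT W'W XW'; rewrite /total_corr (bigD1 i) // [X in _ <= X - _](bigD1 i) //=.
rewrite (@eq_entropy _ _ p_pmf _ _ (fun s => (X i s, W' s))
   (fun s => (X i s, W s))); last first.
  move=> s s'; split=> -[e1 e2]; congr pair => //; first exact: W'W.
  exact: XW'.
rewrite (@eq_entropy _ _ p_pmf _ _ (fun s => (joint (enum T) s, W' s))
   (fun s => (joint (enum T) s, W s))); last first.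
  move=> s s'; split=> -[e1 e2]; congr pair => //; first exact: W'W.
  by apply: XW' => //; apply: (joint_inj e1); rewrite mem_enum.
suff : \sum_(j | (j \in T) && (j != i))
         (entropy p (fun s => (X j s, W' s)) - entropy p W') <=
       \sum_(j | (j \in T) && (j != i))
         (entropy p (fun s => (X j s, W s)) - entropy p W) by entropy_lra.
apply: leR_sum => j _.
have := entropy_submod p_pmf (X j) W' W.
rewrite (@eq_entropy _ _ p_pmf _ _ (fun s => (X j s, (W' s, W s)))
   (fun s => (X j s, W' s))) => [|s s']; last first.
  by split=> [[-> ->]|[-> e]] //; rewrite e (W'W _ _ e).
rewrite (@eq_entropy _ _ p_pmf _ _ (fun s => (W' s, W s)) W') => [|s s'].
  by entropy_lra.
by split=> [[->]|e] //; rewrite e (W'W _ _ e).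
Qed.

(** Given [(K, W)] the total correlation is still nonnegative. Passing from [W] to [(K, W)] lowers
    each single term by at least H(K|W) - [delta], and the joint term by at most H(K|W), which
    leaves a factor [#|T| - 1]. *)
Lemma key_entropy_le (T : {set I}) (V Z : eqType) (W : S -> V) (K : S -> Z)
    (delta : R) :
  (forall i, i \in T ->
     entropy p (fun s => (K s, (X i s, W s))) -
     entropy p (fun s => (X i s, W s)) <= delta) ->
  (INR #|T| - 1) * (entropy p (fun s => (K s, W s)) - entropy p W) <=
  total_corr T W + INR #|T| * delta.
Proof.
move=> hK.
have := joint_entropy_le (fun s => (K s, W s)) (enum T); rewrite big_enum /=.
have : entropy p (fun s => (joint (enum T) s, W s)) <=
       entropy p (fun s => (joint (enum T) s, (K s, W s))).
  by apply: entropy_le => // s s' [-> _ ->].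
have : \sum_(i in T) (entropy p (fun s => (X i s, (K s, W s))) -
          entropy p (fun s => (K s, W s))) <=
       \sum_(i in T) (entropy p (fun s => (X i s, W s)) - entropy p W) +
       \sum_(i in T) (delta - (entropy p (fun s => (K s, W s)) - entropy p W)).
  rewrite -big_split; apply: leR_sum => i /hK /=.
  rewrite (@eq_entropy _ _ p_pmf _ _ (fun s => (K s, (X i s, W s)))
    (fun s => (X i s, (K s, W s)))) => [|s s']; first entropy_lra.
  by split=> -[-> -> ->].
rewrite sumR_const /total_corr; entropy_lra.
Qed.

End TotalCorrelation.

(** * Memoryless sources and the converse bound for silent terminals *)

Lemma ln_INR_exp a n : (0 < a)%N -> ln (INR (a ^ n)%N) = INR n * ln (INR a).
Proof.
move=> a0; have a0' : 0 < INR a by apply/lt_0_INR/ltP.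
elim: n => [|n IH]; first by rewrite expn0 ln_1 Rmult_0_l.
rewrite expnS mult_INR ln_mult ?IH ?S_INR //; first by ring.
by apply/lt_0_INR/ltP; rewrite expn_gt0 a0.
Qed.

Lemma ln_prod (I : finType) (a : I -> R) : (forall i, 0 < a i) ->
  ln (\prod_i a i) = \sum_i ln (a i).
Proof.
move=> a0.
suff [] : 0 < \prod_i a i /\ ln (\prod_i a i) = \sum_i ln (a i) by [].
elim/big_rec2: _ => [|i y x _ [x0 xy]]; first by rewrite ln_1; split=> //; lra.
by rewrite -xy ln_mult //; split=> //; apply: Rmult_lt_0_compat.
Qed.

Lemma prod_eq0 (I : finType) (a : I -> R) i : a i = 0 -> \prod_i a i = 0.
Proof. by move=> ai; rewrite (bigD1 i) //= ai Rmult_0_l. Qed.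

Section Source.

Variables (A : finType) (m : nat) (P : letter A m -> R).
Hypothesis P_pmf : is_pmf P.

Lemma pnE n (x : block A m n) : pn P x = \prod_t P (x t).
Proof. exact: prodRE. Qed.

Lemma pn_pmf n : is_pmf (pn P (n:=n)).
Proof.
split=> [x|].
  rewrite pnE; elim/big_ind: _ => [|x1 x2|t _]; first lra.
    exact: Rmult_le_pos.
  exact: pmf_ge0.
rewrite sumRE; under eq_bigr do rewrite pnE.
rewrite -(bigA_distr_bigA (fun _ => P)) big1 // => t _; exact: pmf_sum.
Qed.

(** The integrand is a product over all times, with [g] inserted at time [t] only; exchanging
    product and sum leaves total mass 1 at every other time. *)
Lemma pn_marginal n (t : 'I_n) (g : letter A m -> R) :
  \sum_(x : block A m n) pn P x * g (x t) = \sum_l P l * g l.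
Proof.
pose G s l := P l * (if s == t then g l else 1).
transitivity (\sum_(x : block A m n) \prod_s G s (x s)).
  apply: eq_bigr => x _; rewrite /G big_split /= -pnE; congr (_ * _).
  by rewrite -big_mkcond (big_pred1 t).
rewrite -(bigA_distr_bigA G) (bigD1 t) //= [X in _ * X]big1 => [|s /negPf st].
  by rewrite Rmult_1_r /G eqxx.
rewrite -(pmf_sum P_pmf); apply: eq_bigr => l _.
by rewrite /G st Rmult_1_r.
Qed.

Lemma pn_prob n (E : 'I_n -> pred (letter A m)) :
  prob (pn P (n:=n)) (fun x => [forall t, E t (x t)]) = \prod_t prob P (E t).
Proof.
transitivity (\prod_t \sum_l (if E t l then P l else 0)); last first.
  by apply: eq_bigr => t _; rewrite probE [RHS]big_mkcond.
rewrite (bigA_distr_bigA (fun t l => if E t l then P l else 0)).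
rewrite probE big_mkcond; apply: eq_bigr => x _; case: ifP => [/forallP Ex|].
  by rewrite pnE; apply: eq_bigr => t _; rewrite Ex.
move=> /negbT; rewrite negb_forall => /existsP [t /negPf nE].
by rewrite (@prod_eq0 _ _ t) ?nE.
Qed.

(** Independence turns the logarithm of a fibre's probability into a sum over times, and each time
    has the marginal [P]. *)
Lemma entropy_pn n (T : eqType) (phi : letter A m -> T) :
  entropy (pn P (n:=n)) (fun x => [ffun t => phi (x t)]) =
  INR n * entropy P phi.
Proof.
rewrite !entropyE.
pose g l := - ln (prob P (fun l' => phi l' == phi l)).
transitivity (\sum_(x : block A m n) pn P x * \sum_t g (x t)).
  apply: eq_bigr => x _.
  case: (pmf_ge0 (pn_pmf n) x) => [px|<-]; last by rewrite !Rmult_0_l.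
  congr (_ * _); rewrite sumR_opp; congr (- _).
  (* In a block of positive mass every letter has positive mass, so all factors of the product are
     positive. *)
  rewrite -ln_prod => [|t]; last first.
    apply: (@prob_gt0 _ _ P_pmf _ (x t)) => //.
    case: (pmf_ge0 P_pmf (x t)) => // p0.
    by move: px; rewrite pnE (@prod_eq0 _ _ t) -?p0 //; lra.
  rewrite -pn_prob; congr ln; apply: eq_prob => x'; apply/eqP/forallP.
    by move=> /ffunP e t; apply/eqP; have := e t; rewrite !ffunE.
  by move=> e; apply/ffunP => t; rewrite !ffunE; apply/eqP/e.
transitivity (\sum_(x : block A m n) \sum_t pn P x * g (x t)).
  by apply: eq_bigr => x _; rewrite big_distrr.
rewrite exchange_big /= (eq_bigr (fun=> \sum_l P l * g l)) => [|t _].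
  by rewrite (sumR_const predT) card_ord.
exact: pn_marginal.
Qed.

(** Entropy depends only on fibres, so any encoding of the observations of [B] serves. This bridges
    per-terminal sequences and per-time letters. *)
Lemma entropy_block n (V : eqType) (f : block A m n -> V) (B : {set 'I_m}) :
  (forall x x', f x = f x' <-> (forall i, i \in B -> obs i x = obs i x')) ->
  entropy (pn P (n:=n)) f = INR n * HX P B.
Proof.
move=> fB; rewrite /HX -entropy_pn; apply: eq_entropy; first exact: pn_pmf.
move=> x x'; rewrite fB; split=> [e | /ffunP e i iB].
  apply/ffunP => t; rewrite !ffunE; apply/ffunP => i; rewrite !ffunE.
  by case: ifP => // iB; have /ffunP/(_ t) := e i iB; rewrite !ffunE => ->.
apply/ffunP => t; rewrite !ffunE.
by have := e t; rewrite !ffunE => /ffunP/(_ i); rewrite !ffunE iB => -[].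
Qed.

(** The value before any transmission, when the transcript is empty. *)
Lemma total_corr_block n (T : {set 'I_m}) :
  total_corr (pn P (n:=n)) (fun i x => obs i x) T (fun _ => [::] : seq nat) =
  INR n * (\sum_(i in T) HX P [set i] - HX P T).
Proof.
(* A constant carries the observations of the empty set of terminals. *)
have H0 : entropy (pn P (n:=n)) (fun _ => [::] : seq nat) = 0.
  rewrite -(Rmult_0_r (INR n)) (@entropy_block _ _ _ set0).
    congr (_ * _); rewrite /HX entropyE big1 // => l _.
    rewrite (_ : prob _ _ = 1) ?ln_1; first by ring.
    rewrite -(pmf_sum P_pmf) probE; apply: eq_bigl => l'.
    by apply/eqP/ffunP => i; rewrite !ffunE inE.
  by move=> x x'; split=> // _ i; rewrite inE.
rewrite /total_corr H0 Rmult_minus_distr_l big_distrr /=.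
congr (_ - _).
  apply: eq_bigr => i _; rewrite (@entropy_block _ _ _ [set i]).
    exact: Rminus_0_r.
  move=> x x'; split=> [[e] j /set1P ->//|e].
  by rewrite (e i) ?set11.
rewrite (@entropy_block _ _ _ T).
  exact: Rminus_0_r.
move=> x x'; split=> [[e] i iT|e].
  by apply: (joint_inj e); rewrite mem_enum.
congr pair; apply/eq_in_map => i; rewrite mem_enum; exact: e.
Qed.

(** Induction on the protocol, one [total_corr_step] per transmission. [acc] is a function of the
    block so that the hypothesis applies to a transcript already begun; [rcons] is injective, so the
    longer transcript determines the shorter. *)
Lemma total_corr_run n (T : {set 'I_m}) (pr : protocol A m n)
    (acc : block A m n -> seq nat) : speakers_in T pr ->
  total_corr (pn P (n:=n)) (fun i x => obs i x) T (fun x => run pr x (acc x)) <=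
  total_corr (pn P (n:=n)) (fun i x => obs i x) T acc.
Proof.
elim: pr acc => [|[i g] pr IH] acc /=; first by move=> _; apply: Rle_refl.
move=> /andP[iT /IH le].
apply: Rle_trans (le (fun x => rcons (acc x) (g (obs i x) (acc x)))) _.
apply: (total_corr_step (pn_pmf n) iT) => [x x' /rcons_inj[]//|x x' -> ->//].
Qed.

Lemma key_bound n (T : {set 'I_m}) (F : protocol A m n)
    (K : block A m n -> nat) (Js : 'I_m -> {ffun 'I_n -> A} -> seq nat -> nat)
    (e : R) :
  speakers_in T F ->
  1 - e <= prob (pn P (n:=n))
    (fun x => [forall i, Js i (obs i x) (transcript F x) == K x]) ->
  (INR #|T| - 1) * (entropy (pn P (n:=n)) K -
                    mutinf (pn P (n:=n)) K (transcript F)) <=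
  INR n * (\sum_(i in T) HX P [set i] - HX P T) +
  INR #|T| * (ln 2 + e * (INR n * ln (INR #|{: letter A m}|))).
Proof.
move=> FT he; rewrite -total_corr_block.
have p_pmf := pn_pmf n.
have hK i : i \in T ->
    entropy (pn P (n:=n)) (fun x => (K x, (obs i x, transcript F x))) -
    entropy (pn P (n:=n)) (fun x => (obs i x, transcript F x)) <=
    ln 2 + e * (INR n * ln (INR #|{: letter A m}|)).
  (* Fano is applied on the space of blocks, whose log-cardinality is linear in [n]. *)
  move=> _; rewrite -ln_INR_exp; last exact: (card_pmf_gt0 P_pmf).
  have := @fano _ _ p_pmf _ _ K (fun x => (obs i x, transcript F x))
    (fun y => Js i y.1 y.2) e.
  rewrite card_ffun card_ord; apply.
  by apply: Rle_trans he _; apply: prob_le => // x /forallP.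
(* H(K) - I(K;F) = H(K|F), the quantity that [key_entropy_le] bounds. *)
have -> : entropy (pn P (n:=n)) K - mutinf (pn P (n:=n)) K (transcript F) =
    entropy (pn P (n:=n)) (fun x => (K x, transcript F x)) -
    entropy (pn P (n:=n)) (transcript F) by rewrite /mutinf; entropy_lra.
apply: Rle_trans (key_entropy_le p_pmf hK) _.
apply: Rplus_le_compat_r; exact: (total_corr_run (fun=> [::])).
Qed.

(** Dividing [key_bound] by [n] and by [#|T| - 1] leaves the claimed bound plus errors that vanish
    as [n] grows and [e] tends to 0. *)
Lemma silent_converse (T : {set 'I_m}) (Rate : R) : (2 <= #|T|)%N ->
  achievable_T P T Rate ->
  Rate <= / (INR #|T| - 1) * (\sum_(i in T) HX P [set i] - HX P T).
Proof.
move=> T2 [F [K [FT [CR SK]]]].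
set TC := _ - HX P T; set t := INR #|T|; set L := ln (INR #|{: letter A m}|).
have t2 : 2 <= t by rewrite -[2]/(INR 2); apply/le_INR/leP.
have L0 : 0 <= L.
  rewrite /L -ln_1; have : 1 <= INR #|{: letter A m}|.
    by rewrite -[1]/(INR 1); apply/le_INR/leP/(card_pmf_gt0 P_pmf).
  by case=> [lt|<-]; [left; apply: ln_increasing; lra | right].
have ln2 : 0 <= ln 2 by rewrite -ln_1; left; apply: ln_increasing; lra.
(* The 2 pays for the slack in the rate and for the leakage; the other two terms pay for the Fano
   error. *)
set C := 2 + t * ln 2 + t * L.
have C0 : 0 < C.
  have := Rmult_le_pos t (ln 2); have := Rmult_le_pos t L; rewrite /C; lra.
suff main e : 0 < e < 1 -> Rate <= / (t - 1) * TC + e * C.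
  apply: Rnot_lt_le => lt.
  set d := Rate - / (t - 1) * TC.
  have d0 : 0 < d by rewrite /d; lra.
  have dC : 0 < d * / (2 * C).
    by apply: Rmult_lt_0_compat => //; apply: Rinv_0_lt_compat; lra.
  (* This [e] is below 1 and has [e * C <= d / 2], whereas [main] would give [d <= e * C]. *)
  set e := Rmin (/ 2) (d * / (2 * C)).
  have e_le : e <= d * / (2 * C) by apply: Rmin_r.
  have e01 : 0 < e < 1.
    have e_le2 : e <= / 2 by apply: Rmin_l.
    by split; [apply: Rmin_pos => //; lra | lra].
  have := main e e01; have := Rmult_le_compat_r C _ _ (Rlt_le _ _ C0) e_le.
  have -> : d * / (2 * C) * C = d / 2 by field; lra.
  rewrite /d; lra.
move=> e01.
have [N1 hN1] := CR e e01; have [N2 hN2] := SK e (proj1 e01).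
have [N3 [hN3 /ltP N3_gt0]] := archimed_cor1 e (proj1 e01).
(* [N1] serves recovery, [N2] secrecy and rate, and [N3] makes [n] positive with [/ INR n <= e]. *)
pose n := maxn (maxn N1 N2) N3.
have [|Js hJ] := hN1 n; first by rewrite /n !leq_max leqnn.
have [|I_le H_ge] := hN2 n; first by rewrite /n !leq_max leqnn orbT.
have := @key_bound n T (F n) (K n) Js e (FT n) (Rge_le _ _ hJ).
move: I_le H_ge; rewrite -/TC -/t -/L.
move: (mutinf _ _ _) (entropy _ _) => I H I_le H_ge key.
have n_gt0 : 0 < INR n.
  by apply/lt_0_INR/ltP; rewrite /n leq_max N3_gt0 orbT.
set v := / INR n in H_ge.
have v0 : 0 < v by apply: Rinv_0_lt_compat.
have v_le : v <= e.
  apply: Rle_trans (Rlt_le _ _ hN3); apply: Rinv_le_contravar.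
    by apply/lt_0_INR/ltP.
  by apply/le_INR/leP; rewrite /n leq_max leqnn orbT.
set k := / (t - 1).
have k0 : 0 < k by apply: Rinv_0_lt_compat; lra.
have k1 : k <= 1 by rewrite -Rinv_1; apply: Rinv_le_contravar; lra.
set Y := INR n * TC + t * (ln 2 + e * (INR n * L)) in key.
have H_le : H <= e + k * Y.
  have := Rmult_le_compat_l _ _ _ (Rlt_le _ _ k0) key.
  have -> : k * ((t - 1) * (H - I)) = H - I by rewrite /k; field; lra.
  lra.
have vH_le := Rmult_le_compat_l _ _ _ (Rlt_le _ _ v0) H_le.
(* [v * Y = TC + Z], so [Z] is the Fano error per source letter. *)
set Z := v * (t * ln 2) + e * (t * L).
have vY : v * (e + k * Y) = v * e + k * TC + k * Z.
  by rewrite /Y /Z /v; field; lra.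
have tln2 : 0 <= t * ln 2 by apply: Rmult_le_pos; lra.
have tL : 0 <= t * L by apply: Rmult_le_pos; lra.
have etL : 0 <= e * (t * L) by apply: Rmult_le_pos; lra.
have vln2 : 0 <= v * (t * ln 2) by apply: Rmult_le_pos; lra.
have kZ : k * Z <= 1 * Z by apply: Rmult_le_compat_r => //; rewrite /Z; lra.
have ve : v * e <= 1 * e by apply: Rmult_le_compat_r; lra.
have := Rmult_le_compat_r _ _ _ tln2 v_le.
rewrite /C; rewrite /Z in vY kZ; lra.
Qed.

End Source.

(** * Comparison with the multipartite information *)

Lemma MI_ge (A : finType) (m : nat) (P : letter A m -> R) (a : R) :
  (forall Q, Q = singletons m \/ admissible Q -> a <= Defs.Delta P Q) ->
  a <= MI P.
Proof.
move=> aD; rewrite /MI.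
have : all (@admissible m) (enum (@admissible m)).
  by apply/allP => Q; rewrite mem_enum.
(* The base case is the seed of the fold, the singleton partition, which is why the hypothesis lists
   it separately. *)
elim: (enum _) => [_|Q r IH /= /andP[Qa /IH]]; first by apply: aD; left.
by apply: Rmin_glb; apply: aD; right.
Qed.

(** A constant key with no communication; it supplies the nonemptiness needed for a supremum to
    exist. *)
Lemma achievable_T0 (A : finType) (m : nat) (P : letter A m -> R)
  (T : {set 'I_m}) : is_pmf P -> achievable_T P T 0.
Proof.
move=> P_pmf; exists (fun _ => [::]), (fun _ _ => 0%N).
have prob1 n (E : pred (block A m n)) : (forall x, E x) ->
    prob (pn P (n:=n)) E = 1.
  by move=> Ex; rewrite -(pmf_sum (pn_pmf P_pmf n)) probE; apply: eq_bigl.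
have H0 n (V : eqType) (f : block A m n -> V) : (forall x x', f x = f x') ->
    entropy (pn P (n:=n)) f = 0.
  move=> fc; rewrite entropyE big1 // => x _; rewrite prob1 ?ln_1; first by ring.
  by move=> x'; apply/eqP.
split=> //; split=> e he; exists 0%N => n _.
  exists (fun _ _ _ => 0%N); rewrite prob1; first lra.
  by move=> x; apply/forallP.
by rewrite /mutinf !H0 // Rmult_0_r; split; lra.
Qed.

Lemma card_singletons m : #|singletons m| = m.
Proof. by rewrite card_imset ?card_ord //; exact: set1_inj. Qed.

Lemma Delta_singletons (A : finType) (m : nat) (P : letter A m -> R) :
  Defs.Delta P (singletons m) =
  / INR (m - 1) * (\sum_i HX P [set i] - HX P [set: 'I_m]).
Proof.
rewrite /Defs.Delta card_singletons sumRE big_imset //=.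
by move=> i j _ _; exact: set1_inj.
Qed.

Lemma admissible_split m (u : 'I_m) : (2 <= m)%N ->
  admissible [set [set~ u]; [set u]] /\ #|[set [set~ u]; [set u]]| = 2%N.
Proof.
move=> m2.
have ne : [set~ u] != [set u].
  by apply/eqP => /setP/(_ u); rewrite !inE eqxx.
have c2 : #|[set [set~ u]; [set u]]| = 2%N by rewrite cards2 ne.
split=> //; rewrite /admissible c2 andbT; apply/and3P; split.
- apply/eqP; rewrite /cover bigcup_setU !big_set1; apply/setP => i.
  by rewrite !inE; case: eqP.
- apply/trivIsetP => B C; rewrite !inE => /orP[]/eqP-> /orP[]/eqP->;
    rewrite ?eqxx // => _; rewrite -setI_eq0 ?setICr //.
  by rewrite setIC setICr.
- rewrite !inE negb_or; apply/andP; split; rewrite eq_sym -card_gt0 ?cards1 //.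
  by rewrite cardsC1 card_ord -ltnS prednK // ltnW.
Qed.

Theorem theorem4 (A : finType) (m : nat) (P : letter A m -> R) :
  (3 <= m)%N ->
  is_pmf P ->
  strict_typeS P ->
  forall T : {set 'I_m}, #|T| = (m - 1)%N ->
    exists c : R, I_T P T c /\ Rlt c (MI P).
Proof.
move=> m3 P_pmf strict T cT.
set TC := \sum_(i in T) HX P [set i] - HX P T.
have ub : is_upper_bound (achievable_T P T) (/ (INR #|T| - 1) * TC).
  move=> r; apply: silent_converse; rewrite // cT.
  by case: m m3 {P P_pmf strict T cT TC} => [|[|[]]].
have [||c lub_c] := completeness (achievable_T P T).
- by exists (/ (INR #|T| - 1) * TC).
- by exists 0; apply: achievable_T0.
exists c; split=> //.
apply: (@Rle_lt_trans _ (/ (INR #|T| - 1) * TC)); first exact: (proj2 lub_c).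
have [u Tu] : exists u, T = [set~ u].
  have /cards1P [u Tu] : #|~: T| == 1%N.
    rewrite -(eqn_add2l #|T|) cardsC card_ord cT subnK //.
    exact: leq_trans m3.
  by exists u; rewrite -Tu setCK.
apply: (@Rlt_le_trans _ (Defs.Delta P (singletons m))); last first.
  apply: MI_ge => Q [->|aQ]; first exact: Rle_refl.
  have [->|nQ] := eqVneq Q (singletons m); first exact: Rle_refl.
  by left; apply: strict.
have [|aQ cQ] := @admissible_split m u; first exact: ltnW.
have := strict _ aQ.
(* Two cells against at least three: [m >= 3] makes strictness applicable. *)
have -> : [set [set~ u]; [set u]] != singletons m.
  by apply/eqP => e; move: m3; rewrite -(card_singletons m) -e cQ.
move=> /(_ isT).
have -> : Defs.Delta P [set [set~ u]; [set u]] =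
    HX P T + HX P [set u] - HX P [set: 'I_m].
  rewrite /Defs.Delta cQ /= Rinv_1 Rmult_1_l sumRE; congr (_ - _).
  rewrite -Tu big_setU1 ?big_set1 //= inE.
  by apply/eqP => /setP/(_ u); rewrite Tu !inE eqxx.
rewrite Delta_singletons (bigID (mem T)) /=.
have -> : \sum_(i | i \notin T) HX P [set i] = HX P [set u].
  by rewrite (big_pred1 u) // => i; rewrite Tu !inE negbK.
rewrite cT.
have k2 : 2 <= INR (m - 1).
  by rewrite -[2]/(INR 2); apply/le_INR/leP; clear -m3; case: m m3 => [|[|[]]].
move: k2; rewrite /TC.
move: (INR _) (\sum_(i in T) _) (HX P T) (HX P [set u]) (HX P [set: _]).
move=> k a b h w k2; set D := / k * _ => lt.
(* With [k = m - 1], strictness reads [D < b + h - w]; subtracting it from [kD] gives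
   [(k - 1) * D > a - b]. *)
have kD : k * D = a + h - w by rewrite /D; field; lra.
have -> : D = / (k - 1) * ((k - 1) * D) by field; lra.
apply: Rmult_lt_compat_l; first by apply: Rinv_0_lt_compat; lra.
lra.
Qed.
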